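(* Let $(\mathbf{Base}, X)$ be an optimization domain. For an objective $l : A \to X$ define, whenever the expressions make sense, \[ \mathrm{GRAD}(l) = -R[l]_1 : A \to A, \] \[ \mathrm{MOM}(l) = \langle \pi_1, -\pi_1 - (R[l]_1 \circ \pi_0)\rangle : A^2 \to A^2, \] \[ \mathrm{NEW}(l) = -R[R[l]_1^{-1}] \circ \langle R[l]_1, R[l]_1 \rangle : A \to A, \] regarded as generalized optimizers with state space $A$ of dimension $1$, $2$ and $1$ respectively, and let each of these assignments act as the identity on morphisms (sending $f: A \to B$ in $\mathbf{Base}$ to the same $f$). Then: (i) generalized Newton's method $\mathrm{NEW}$ is a functor from $\mathbf{Objective}_{I}$ to $\mathbf{Optimizer}$; (ii) generalized gradient descent $\mathrm{GRAD}$ and generalized momentum $\mathrm{MOM}$ are functors from $\mathbf{Objective}_{\perp}$ to $\mathbf{Optimizer}$.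
   Context: Cartesian left additive category: a category $\mathbf{C}$ with finite products (terminal object $*$, unique maps $!_A : A \to *$, projections $\pi_0,\pi_1$, pairing $\langle -,-\rangle$) in which every hom-set $\mathbf{C}[B,C]$ is a commutative monoid $(+, 0_{BC})$ such that $(f+g)\circ h = (f\circ h)+(g\circ h)$, $0_{BC}\circ h = 0_{AC}$ for all $h: A \to B$, and $\pi_i\circ(f+g) = (\pi_i\circ f)+(\pi_i\circ g)$, $\pi_i \circ 0 = 0$ for all projections $\pi_i$. Write $\iota_0 = \langle 1, 0\rangle : A \to A\times B$ and $\iota_1 = \langle 0, 1\rangle : B \to A \times B$. $A^k$, $f^k$ denote $k$-fold products. Cartesian reverse derivative category: a Cartesian left additive category with a combinator $R$ assigning to each $f: A \to B$ a morphism $R[f]: A\times B \to A$ such that RD.1: $R[f+g]=R[f]+R[g]$, $R[0]=0$; RD.2: $R[f]\circ\langle a,b+c\rangle = R[f]\circ\langle a,b\rangle + R[f]\circ\langle a,c\rangle$, $R[f]\circ\langle a,0\rangle=0$; RD.3: $R[1]=\pi_1$, $R[\pi_0]=\iota_0\circ\pi_1$, $R[\pi_1]=\iota_1\circ\pi_1$; RD.4: $R[\langle f,g\rangle]=R[f]\circ(1\times\pi_0)+R[g]\circ(1\times\pi_1)$, $R[!_A]=0$; RD.5: $R[g\circ f]=R[f]\circ(1\times R[g])\circ\langle\pi_0,\langle f\circ\pi_0,\pi_1\rangle\rangle$; RD.6: $\pi_1\circ R[R[R[f]]]\circ(\iota_0\times 1)\circ\langle 1\times\pi_0, 0\times\pi_1\rangle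 = R[f]\circ(1\times\pi_1)$; RD.7: with $D[f] := \pi_1\circ R[R[f]]\circ(\iota_0\times 1) : A \times A \to B$, one has $D[D[f]] = D[D[f]]\circ\langle\pi_0\times\pi_0,\pi_1\times\pi_1\rangle$. In such a category $D$ is called the Cartesian derivative combinator (it makes the category a Cartesian differential category). A morphism $f : A \to B$ is linear if $D[f]=f\circ\pi_1$. Linear maps form a subcategory with an identity-on-objects contravariant involution $f\mapsto f^\dagger$ (a linear $f:A\to B$ gives a linear $f^\dagger: B\to A$) characterised by $R[f]=f^\dagger\circ\pi_1$ for linear $f$. Optimization domain $(\mathbf{Base},X)$: $\mathbf{Base}$ is a Cartesian reverse derivative category in which every morphism $f$ has an additive inverse $-f$, and each hom-set $\mathbf{Base}[*,A]$ carries a multiplication and a multiplicative identity $1_A : * \to A$ making it, with $+$, a commutative ring; $X$ is an object of $\mathbf{Base}$ such that $\mathbf{Base}[*,X]$ is further equipped with a total order making it an ordered commutative ring. An objective is a morphism $l: A\to X$. Write $1_{AB} = 1_B\circ !_A : A \to B$. Generalized gradient of $l: A \to X$: $R[l]_1 = R[l]\circ\langle id_A, 1_{AX}\rangle : A\to A$. $\mathbf{Objective}$: objects are objectives $l: A\to X$ for which $R[l]_1$ has a two-sided inverse $R[l]_1^{-1}: A\to A$ in $\mathbf{Base}$; morphisms from $l: A\to X$ to $l': B\to X$ are morphisms $f: A\to B$ of $\mathbf{Base}$ with $l'\circ f=l$. $\mathbf{Objective}_I$ is the subcategory of $\mathbf{Objective}$ with the same objects whose morphisms $f$ are those that are invertible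 and linear in $\mathbf{Base}$. $\mathbf{Objective}_\perp$ is the subcategory of $\mathbf{Objective}_I$ with the same objects whose morphisms $f$ satisfy $f^{-1}=f^\dagger$. $\mathbf{Optimizer}$: objects are generalized optimizers, i.e. endomorphisms $d: A^k\to A^k$ in $\mathbf{Base}$ with specified state space $A$ and dimension $k\in\mathbb{N}$; morphisms from $d: A^k\to A^k$ to $d': B^k\to B^k$ (same $k$) are $\mathbf{Base}$-morphisms $f: A\to B$ with $f^k\circ d = d'\circ f^k$; composition is as in $\mathbf{Base}$. *)

(* Defs.v *)
From mathcomp Require Import all_boot.
From Stdlib Require Import ProofIrrelevance.

Set Implicit Arguments.
Unset Strict Implicit.
Unset Printing Implicit Defensive.

Declare Scope cat_scope.
Delimit Scope cat_scope with cat.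
Local Open Scope cat_scope.

Record category := Category {
  ob :> Type;
  hom : ob -> ob -> Type;
  idm : forall A : ob, hom A A;
  compose : forall A B C : ob, hom B C -> hom A B -> hom A C;
  compA : forall (A B C D : ob) (h : hom C D) (g : hom B C) (f : hom A B),
    compose h (compose g f) = compose (compose h g) f;
  comp1m : forall (A B : ob) (f : hom A B), compose (idm B) f = f;
  compm1 : forall (A B : ob) (f : hom A B), compose f (idm A) = f
}.

Arguments hom {_} _ _.
Arguments idm {_ _}.
Arguments compose {_ _ _ _} _ _.

Notation "g ∘ f" := (compose g f) (at level 40, left associativity) : cat_scope.

Definition is_inverse (C : category) (A B : C) (f : hom A B) (g : hom B A) :=
  g ∘ f = idm /\ f ∘ g = idm.

Definition invertible (C : category) (A B : C) (f : hom A B) :=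
  exists g : hom B A, is_inverse f g.

(* The functor structures whose action on objects is the given map [Fo]. *)
Record functor_over (C D : category) (Fo : C -> D) := FunctorOver {
  fmap : forall A B : C, hom A B -> hom (Fo A) (Fo B);
  fmap1 : forall A : C, fmap (@idm C A) = idm;
  fmapM : forall (A B E : C) (g : hom B E) (f : hom A B),
    fmap (g ∘ f) = fmap g ∘ fmap f
}.

Section WideSubcategory.
Context (C : category) (P : forall A B : C, hom A B -> Prop).
Arguments P {A B} _.
Context (P1 : forall A : C, P (@idm C A))
  (PM : forall (A B E : C) (g : hom B E) (f : hom A B), P g -> P f -> P (g ∘ f)).

Record wide_hom (A B : C) := WideHom { wide_mor : hom A B; wide_prop : P wide_mor }.

Lemma wide_hom_eq (A B : C) (f g : wide_hom A B) :
  wide_mor f = wide_mor g -> f = g.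
Proof.
case: f g => [f pf] [g pg] /= efg; move: pg; rewrite -efg => pg.
by rewrite (proof_irrelevance _ pf pg).
Qed.

Definition wide_subcategory : category.
Proof.
refine (@Category C wide_hom (fun A => WideHom (P1 A))
  (fun A B E g f => WideHom (PM (wide_prop g) (wide_prop f))) _ _ _).
- by move=> A B E D h g f; apply: wide_hom_eq; rewrite /= compA.
- by move=> A B f; apply: wide_hom_eq; rewrite /= comp1m.
- by move=> A B f; apply: wide_hom_eq; rewrite /= compm1.
Defined.

End WideSubcategory.

Record cartesian_category := CartesianCategory {
  cart_cat :> category;
  terminal : cart_cat;
  bang : forall A : cart_cat, hom A terminal;
  bang_unique : forall (A : cart_cat) (f : hom A terminal), f = bang A;
  prodo : cart_cat -> cart_cat -> cart_cat;
  proj0 : forall A B : cart_cat, hom (prodo A B) A;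
  proj1 : forall A B : cart_cat, hom (prodo A B) B;
  pairing : forall Z A B : cart_cat, hom Z A -> hom Z B -> hom Z (prodo A B);
  proj0_pair : forall (Z A B : cart_cat) (f : hom Z A) (g : hom Z B),
    proj0 A B ∘ pairing f g = f;
  proj1_pair : forall (Z A B : cart_cat) (f : hom Z A) (g : hom Z B),
    proj1 A B ∘ pairing f g = g;
  pair_unique : forall (Z A B : cart_cat) (h : hom Z (prodo A B)),
    h = pairing (proj0 A B ∘ h) (proj1 A B ∘ h)
}.

Arguments terminal {_}.
Arguments bang {_} _.
Arguments prodo {_} _ _.
Arguments proj0 {_ _ _}.
Arguments proj1 {_ _ _}.
Arguments pairing {_ _ _ _} _ _.

Notation "A × B" := (prodo A B) (at level 40, left associativity) : cat_scope.
Notation "⟨ f , g ⟩" := (pairing f g)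
  (at level 0, f at level 99, g at level 99) : cat_scope.
Notation π0 := proj0.
Notation π1 := proj1.

Definition prodm (C : cartesian_category) (A B A' B' : C)
    (f : hom A A') (g : hom B B') : hom (A × B) (A' × B') :=
  ⟨f ∘ π0, g ∘ π1⟩.
Notation "f ⊗ g" := (prodm f g) (at level 40, left associativity) : cat_scope.

(* The k-fold powers are normalised so that [pow A 1] is [A] and [pow A 2] is
   [A × A] definitionally. *)
Fixpoint pow (C : cartesian_category) (A : C) (k : nat) : C :=
  match k with
  | 0 => terminal
  | k'.+1 => if k' is 0 then A else A × pow A k'
  end.

Fixpoint powm (C : cartesian_category) (A B : C) (f : hom A B) (k : nat) :
    hom (pow A k) (pow B k) :=
  match k return hom (pow A k) (pow B k) with
  | 0 => idm
  | k'.+1 =>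
    match k' return hom (pow A k') (pow B k') -> hom (pow A k'.+1) (pow B k'.+1)
    with
    | 0 => fun _ => f
    | _.+1 => fun fk => f ⊗ fk
    end (powm f k')
  end.

Record left_additive_category := LeftAdditiveCategory {
  lac_cart :> cartesian_category;
  hadd : forall A B : lac_cart, hom A B -> hom A B -> hom A B;
  hzero : forall A B : lac_cart, hom A B;
  haddA : forall A B : lac_cart, associative (@hadd A B);
  haddC : forall A B : lac_cart, commutative (@hadd A B);
  hadd0 : forall A B : lac_cart, left_id (hzero A B) (@hadd A B);
  hadd_comp : forall (A B C : lac_cart) (f g : hom B C) (h : hom A B),
    hadd f g ∘ h = hadd (f ∘ h) (g ∘ h);
  hzero_comp : forall (A B C : lac_cart) (h : hom A B),
    hzero B C ∘ h = hzero A C;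
  proj0_add : forall (Z A B : lac_cart) (f g : hom Z (A × B)),
    π0 ∘ hadd f g = hadd (π0 ∘ f) (π0 ∘ g);
  proj1_add : forall (Z A B : lac_cart) (f g : hom Z (A × B)),
    π1 ∘ hadd f g = hadd (π1 ∘ f) (π1 ∘ g);
  proj0_zero : forall Z A B : lac_cart, π0 ∘ hzero Z (A × B) = hzero Z A;
  proj1_zero : forall Z A B : lac_cart, π1 ∘ hzero Z (A × B) = hzero Z B
}.

Arguments hadd {_ _ _} _ _.
Arguments hzero {_ _ _}.

Notation "f + g" := (hadd f g) : cat_scope.
Notation "0" := hzero : cat_scope.

Definition inj0 (C : left_additive_category) (A B : C) : hom A (A × B) := ⟨idm, 0⟩.
Definition inj1 (C : left_additive_category) (A B : C) : hom B (A × B) := ⟨0, idm⟩.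
Arguments inj0 {_ _ _}.
Arguments inj1 {_ _ _}.
Notation ι0 := inj0.
Notation ι1 := inj1.

Definition reverse_combinator (C : left_additive_category) :=
  forall A B : C, hom A B -> hom (A × B) A.

Definition forward_of (C : left_additive_category) (R : reverse_combinator C)
    (A B : C) (f : hom A B) : hom (A × A) B :=
  π1 ∘ R _ _ (R _ _ f) ∘ (ι0 ⊗ idm).

Record reverse_derivative_category := ReverseDerivativeCategory {
  rdc_lac :> left_additive_category;
  rev : reverse_combinator rdc_lac;
  RD1_add : forall (A B : rdc_lac) (f g : hom A B), rev (f + g) = rev f + rev g;
  RD1_zero : forall A B : rdc_lac, rev (0 : hom A B) = 0;
  RD2_add : forall (Z A B : rdc_lac) (f : hom A B) (a : hom Z A) (b c : hom Z B),
    rev f ∘ ⟨a, b + c⟩ = rev f ∘ ⟨a, b⟩ + rev f ∘ ⟨a, c⟩;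
  RD2_zero : forall (Z A B : rdc_lac) (f : hom A B) (a : hom Z A),
    rev f ∘ ⟨a, 0⟩ = 0;
  RD3_id : forall A : rdc_lac, rev (idm : hom A A) = π1;
  RD3_proj0 : forall A B : rdc_lac, rev (π0 : hom (A × B) A) = ι0 ∘ π1;
  RD3_proj1 : forall A B : rdc_lac, rev (π1 : hom (A × B) B) = ι1 ∘ π1;
  RD4_pair : forall (Z A B : rdc_lac) (f : hom Z A) (g : hom Z B),
    rev ⟨f, g⟩ = rev f ∘ (idm ⊗ π0) + rev g ∘ (idm ⊗ π1);
  RD4_bang : forall A : rdc_lac, rev (bang A) = 0;
  RD5 : forall (A B C : rdc_lac) (g : hom B C) (f : hom A B),
    rev (g ∘ f) = rev f ∘ (idm ⊗ rev g) ∘ ⟨π0, ⟨f ∘ π0, π1⟩⟩;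
  RD6 : forall (A B : rdc_lac) (f : hom A B),
    π1 ∘ rev (rev (rev f)) ∘ (ι0 ⊗ idm) ∘ ⟨idm ⊗ π0, (0 : hom A A) ⊗ π1⟩
    = rev f ∘ (idm ⊗ π1);
  RD7 : forall (A B : rdc_lac) (f : hom A B),
    forward_of rev (forward_of rev f)
    = forward_of rev (forward_of rev f) ∘ ⟨π0 ⊗ π0, π1 ⊗ π1⟩
}.

Notation "'R[' f ]" := (rev f) (at level 0, f at level 99) : cat_scope.
Notation "'D[' f ]" := (forward_of (@rev _) f) (at level 0, f at level 99) : cat_scope.

Definition linear (K : reverse_derivative_category) (A B : K) (f : hom A B) :=
  D[f] = f ∘ π1.

(* The only candidate for a map [g] with [R[f] = g ∘ π1]; [dagger_char] below
   shows that it is one when [f] is linear. *)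
Definition dagger (K : reverse_derivative_category) (A B : K) (f : hom A B) :
    hom B A := R[f] ∘ ι1.
Notation "f ^†" := (dagger f) (at level 2, format "f ^†") : cat_scope.

Section CartesianTheory.
Context (C : cartesian_category).
Implicit Types Z A B : C.

Lemma pair_comp Y Z A B (f : hom Z A) (g : hom Z B) (h : hom Y Z) :
  ⟨f, g⟩ ∘ h = ⟨f ∘ h, g ∘ h⟩.
Proof. by rewrite [LHS]pair_unique !compA proj0_pair proj1_pair. Qed.

Lemma pair_eta A B : ⟨π0, π1⟩ = idm :> hom (A × B) (A × B).
Proof. by rewrite [RHS]pair_unique !compm1. Qed.

Lemma prodm_pair Z A B A' B' (f : hom A A') (g : hom B B') (a : hom Z A)
    (b : hom Z B) : (f ⊗ g) ∘ ⟨a, b⟩ = ⟨f ∘ a, g ∘ b⟩.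
Proof. by rewrite /prodm pair_comp -!compA proj0_pair proj1_pair. Qed.

Lemma prod_ext Z A B (f g : hom (A × B) Z) :
  (forall Y (a : hom Y A) (b : hom Y B), f ∘ ⟨a, b⟩ = g ∘ ⟨a, b⟩) -> f = g.
Proof. by move=> /(_ _ π0 π1); rewrite pair_eta !compm1. Qed.

Lemma powm1 A k : powm (idm : hom A A) k = idm.
Proof.
elim: k => [|[|k] IHk] //=; rewrite -/(powm _ k.+1) in IHk *.
by rewrite IHk /prodm !comp1m pair_eta.
Qed.

Lemma powmM A B E (g : hom B E) (f : hom A B) k :
  powm (g ∘ f) k = powm g k ∘ powm f k.
Proof.
elim: k => [|[|k] IHk] /=; first by rewrite comp1m.
  by [].
by rewrite [RHS]prodm_pair -/(powm (g ∘ f) k.+1) IHk /prodm !compA.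
Qed.

End CartesianTheory.

Section InverseTheory.
Context (C : category).
Implicit Types A B E : C.

Lemma is_inverse1 A : is_inverse (idm : hom A A) idm.
Proof. by split; rewrite comp1m. Qed.

Lemma is_inverseM A B E (g : hom B E) (f : hom A B) g' f' :
  is_inverse g g' -> is_inverse f f' -> is_inverse (g ∘ f) (f' ∘ g').
Proof.
move=> [g'g gg'] [f'f ff']; split.
  by rewrite compA -(compA f') g'g compm1.
by rewrite compA -(compA g) ff' compm1.
Qed.

Lemma invertible1 A : invertible (idm : hom A A).
Proof. by exists idm; exact: is_inverse1. Qed.

Lemma invertibleM A B E (g : hom B E) (f : hom A B) :
  invertible g -> invertible f -> invertible (g ∘ f).
Proof. by move=> [g' ?] [f' ?]; exists (f' ∘ g'); exact: is_inverseM. Qed.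

End InverseTheory.

Section ReverseTheory.
Context (K : reverse_derivative_category).
Implicit Types Z A B : K.

Lemma haddr0 A B (f : hom A B) : f + 0 = f.
Proof. by rewrite haddC hadd0. Qed.

Lemma inj0E Z A B (a : hom Z A) : (ι0 : hom A (A × B)) ∘ a = ⟨a, 0⟩.
Proof. by rewrite /inj0 pair_comp comp1m hzero_comp. Qed.

Lemma inj1E Z A B (b : hom Z B) : (ι1 : hom B (A × B)) ∘ b = ⟨0, b⟩.
Proof. by rewrite /inj1 pair_comp comp1m hzero_comp. Qed.

Lemma rev_comp Z A B E (g : hom B E) (f : hom A B) (a : hom Z A) (c : hom Z E) :
  R[g ∘ f] ∘ ⟨a, c⟩ = R[f] ∘ ⟨a, R[g] ∘ ⟨f ∘ a, c⟩⟩.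
Proof.
rewrite RD5 -!compA; congr (_ ∘ _).
by rewrite !(pair_comp, =^~ compA, proj0_pair, proj1_pair, comp1m).
Qed.

Lemma rev_pair Z A B E (f : hom A B) (g : hom A E) (a : hom Z A) b c :
  R[⟨f, g⟩] ∘ ⟨a, ⟨b, c⟩⟩ = R[f] ∘ ⟨a, b⟩ + R[g] ∘ ⟨a, c⟩.
Proof.
by rewrite RD4_pair hadd_comp -!compA !prodm_pair comp1m proj0_pair proj1_pair.
Qed.

Lemma rev_proj0 Z A B (p : hom Z (A × B)) (a : hom Z A) :
  R[π0] ∘ ⟨p, a⟩ = ⟨a, 0⟩.
Proof. by rewrite RD3_proj0 -compA proj1_pair inj0E. Qed.

Lemma rev_proj1 Z A B (p : hom Z (A × B)) (b : hom Z B) :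
  R[π1] ∘ ⟨p, b⟩ = ⟨0, b⟩.
Proof. by rewrite RD3_proj1 -compA proj1_pair inj1E. Qed.

Lemma forwardE Z A B (f : hom A B) (a a' : hom Z A) :
  D[f] ∘ ⟨a, a'⟩ = π1 ∘ (R[R[f]] ∘ ⟨⟨a, 0⟩, a'⟩).
Proof. by rewrite /forward_of -!compA prodm_pair inj0E comp1m. Qed.

Lemma RD6E Z A B (f : hom A B) (a : hom Z A) (b c : hom Z B) :
  D[R[f]] ∘ ⟨⟨a, b⟩, ⟨0, c⟩⟩ = R[f] ∘ ⟨a, c⟩.
Proof.
have /(congr1 (fun h => h ∘ ⟨a, ⟨b, c⟩⟩)) := RD6 f.
rewrite -/(forward_of (@rev K) R[f]) -!compA pair_comp !prodm_pair !comp1m.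
by rewrite proj0_pair proj1_pair hzero_comp.
Qed.

Lemma rev_comp_pt A B E (g : hom B E) (f : hom A B) :
  R[g ∘ f] = R[f] ∘ ⟨π0, R[g] ∘ ⟨f ∘ π0, π1⟩⟩.
Proof. by rewrite -rev_comp pair_eta compm1. Qed.

Lemma forward_comp Z A B E (g : hom B E) (f : hom A B) (a a' : hom Z A) :
  D[g ∘ f] ∘ ⟨a, a'⟩ = D[g] ∘ ⟨f ∘ a, D[f] ∘ ⟨a, a'⟩⟩.
Proof.
rewrite !forwardE rev_comp_pt rev_comp.
rewrite pair_comp -!compA pair_comp -compA proj0_pair proj1_pair RD2_zero.
set w := R[R[f]] ∘ _.
rewrite {1}[w]pair_unique rev_pair rev_proj0 proj1_add proj1_pair hadd0.
rewrite rev_comp pair_comp -compA proj0_pair proj1_pair.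
set v := R[R[g]] ∘ _.
rewrite {1}[v]pair_unique rev_pair rev_proj1 proj1_add proj1_pair.
by rewrite rev_comp rev_proj0 proj1_pair hadd0.
Qed.

Lemma linearE Z A B (f : hom A B) (a a' : hom Z A) :
  linear f -> D[f] ∘ ⟨a, a'⟩ = f ∘ a'.
Proof. by move=> ->; rewrite -compA proj1_pair. Qed.

Lemma linear1 A : linear (idm : hom A A).
Proof.
apply: prod_ext => Z a b.
by rewrite forwardE RD3_id rev_proj1 proj1_pair comp1m proj1_pair.
Qed.

Lemma linearM A B E (g : hom B E) (f : hom A B) :
  linear g -> linear f -> linear (g ∘ f).
Proof.
move=> lg lf; apply: prod_ext => Z a b.
by rewrite forward_comp !linearE // -!compA proj1_pair.
Qed.

Lemma dagger_char A B (f : hom A B) : linear f -> R[f] = f^† ∘ π1.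
Proof.
move=> lf; apply: prod_ext => Z a b.
have e0 : forall Z' (p : hom Z' (A × A)) (y : hom Z' B),
    π1 ∘ (R[D[f]] ∘ ⟨p, y⟩)
    = π1 ∘ (R[R[R[f]]] ∘ ⟨⟨⟨π0 ∘ p, 0⟩, π1 ∘ p⟩, ⟨0, y⟩⟩).
  move=> Z' p y; rewrite /forward_of !rev_comp rev_proj1.
  rewrite [X in R[_] ∘ ⟨X, ⟨0, y⟩⟩](_ : _ = ⟨⟨π0 ∘ p, 0⟩, π1 ∘ p⟩); last first.
    by rewrite {1}[p]pair_unique prodm_pair inj0E comp1m.
  set w := R[R[R[f]]] ∘ _.
  rewrite {1}[w]pair_unique /prodm rev_pair proj1_add !rev_comp rev_proj1.
  by rewrite RD3_id rev_proj0 !proj1_pair hadd0.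
have := e0 _ ⟨a, 0⟩ b; rewrite proj0_pair proj1_pair -forwardE RD6E => <-.
rewrite lf rev_comp proj1_pair rev_proj1 proj1_pair.
by rewrite /dagger -!compA proj1_pair inj1E.
Qed.

Lemma dagger_unique A B (f : hom A B) (g : hom B A) : R[f] = g ∘ π1 -> g = f^†.
Proof. by move=> Rf; rewrite /dagger Rf -compA proj1_pair compm1. Qed.

Lemma dagger_linear A B (f : hom A B) : linear f -> linear f^†.
Proof.
move=> lf; have lin1 : linear (ι1 : hom B (A × B)).
  apply: prod_ext => Z a b; rewrite -compA proj1_pair.
  rewrite forwardE RD4_pair RD1_zero hzero_comp hadd0 RD3_id proj1_pair.
  by rewrite rev_comp !rev_proj1 proj1_pair inj1E.
apply: prod_ext => Z b c.
rewrite forward_comp (linearE _ _ lin1) !inj1E RD6E.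
by rewrite /dagger -!compA proj1_pair inj1E.
Qed.

Lemma daggerK A B (f : hom A B) : linear f -> f^†^† = f.
Proof.
move=> lf; have := linearE 0 idm lf; rewrite compm1 => {2}<-.
rewrite forwardE (dagger_char lf) rev_comp proj1_pair rev_proj1 proj1_pair.
by rewrite (dagger_char (dagger_linear lf)) -compA proj1_pair compm1.
Qed.

Lemma dagger1 A : (idm : hom A A)^† = idm.
Proof. by rewrite /dagger RD3_id proj1_pair. Qed.

Lemma daggerM A B E (g : hom B E) (f : hom A B) :
  linear g -> linear f -> (g ∘ f)^† = f^† ∘ g^†.
Proof.
move=> lg lf; rewrite {1}/dagger rev_comp (dagger_char lf) (dagger_char lg).
by rewrite -!compA !proj1_pair compm1.
Qed.

End ReverseTheory.

Record optimization_domain := OptimizationDomain {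
  base :> reverse_derivative_category;
  hopp : forall A B : base, hom A B -> hom A B;
  haddN : forall (A B : base) (f : hom A B), f + hopp f = 0;
  ptmul : forall A : base, hom terminal A -> hom terminal A -> hom terminal A;
  ptone : forall A : base, hom terminal A;
  ptmulA : forall A : base, associative (@ptmul A);
  ptmulC : forall A : base, commutative (@ptmul A);
  ptmul1 : forall A : base, left_id (ptone A) (@ptmul A);
  ptmulDl : forall A : base, left_distributive (@ptmul A) (@hadd base terminal A);
  target : base;
  ptle : hom terminal target -> hom terminal target -> Prop;
  ptle_refl : forall x, ptle x x;
  ptle_anti : forall x y, ptle x y -> ptle y x -> x = y;
  ptle_trans : forall x y z, ptle x y -> ptle y z -> ptle x z;
  ptle_total : forall x y, ptle x y \/ ptle y x;
  ptle_add : forall x y z, ptle x y -> ptle (x + z) (y + z);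
  ptle_mul : forall x y, ptle 0 x -> ptle 0 y -> ptle 0 (ptmul x y)
}.

Notation "- f" := (hopp f) : cat_scope.
Notation "f - g" := (f + - g) : cat_scope.

Definition constant_one (K : optimization_domain) (A B : K) : hom A B :=
  ptone B ∘ bang A.

Definition gradient (K : optimization_domain) (A : K) (l : hom A (target K)) :
    hom A A :=
  R[l] ∘ ⟨idm, constant_one A (target K)⟩.

Section Objectives.
Context (K : optimization_domain).

(* Two-sided inverses being unique, carrying the inverse of the gradient as a
   field only amounts to requiring its existence. *)
Record objective := MkObjective {
  obj_space : K;
  obj_map : hom obj_space (target K);
  obj_grad_inv : hom obj_space obj_space;
  obj_grad_invP : is_inverse (gradient obj_map) obj_grad_inv
}.

Record objective_hom (l l' : objective) := ObjectiveHom {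
  obj_mor : hom (obj_space l) (obj_space l');
  obj_morP : obj_map l' ∘ obj_mor = obj_map l
}.

Lemma objective_hom_eq (l l' : objective) (f g : objective_hom l l') :
  obj_mor f = obj_mor g -> f = g.
Proof.
case: f g => [f pf] [g pg] /= efg; move: pg; rewrite -efg => pg.
by rewrite (proof_irrelevance _ pf pg).
Qed.

Definition objective_id (l : objective) : objective_hom l l :=
  ObjectiveHom (compm1 (obj_map l)).

Lemma objective_comp_subproof (l l' l'' : objective) (g : objective_hom l' l'')
    (f : objective_hom l l') : obj_map l'' ∘ (obj_mor g ∘ obj_mor f) = obj_map l.
Proof. by rewrite compA !obj_morP. Qed.

Definition objective_comp (l l' l'' : objective) (g : objective_hom l' l'')
    (f : objective_hom l l') : objective_hom l l'' :=
  ObjectiveHom (objective_comp_subproof g f).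

Definition Objective : category.
Proof.
refine (@Category objective objective_hom objective_id objective_comp _ _ _).
- by move=> *; apply: objective_hom_eq; rewrite /= compA.
- by move=> *; apply: objective_hom_eq; rewrite /= comp1m.
- by move=> *; apply: objective_hom_eq; rewrite /= compm1.
Defined.

Definition invertible_linear (l l' : Objective) (f : hom l l') :=
  invertible (obj_mor f) /\ linear (obj_mor f).

Lemma invertible_linear1 (l : Objective) : invertible_linear (@idm _ l).
Proof. by split; [exact: invertible1 | exact: linear1]. Qed.

Lemma invertible_linearM (l l' l'' : Objective) (g : hom l' l'') (f : hom l l') :
  invertible_linear g -> invertible_linear f -> invertible_linear (g ∘ f).
Proof.
by move=> [ig lg] [jf lf]; split; [exact: invertibleM | exact: linearM].
Qed.

Definition Objective_I : category :=
  wide_subcategory invertible_linear1 invertible_linearM.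

Definition ObjI_mor (l l' : Objective_I) (f : hom l l') :
  hom (obj_space l) (obj_space l') := obj_mor (wide_mor f).

Definition orthogonal (l l' : Objective_I) (f : hom l l') :=
  is_inverse (ObjI_mor f) (ObjI_mor f)^†.

Lemma orthogonal1 (l : Objective_I) : orthogonal (@idm _ l).
Proof. by rewrite /orthogonal /ObjI_mor /= dagger1; exact: is_inverse1. Qed.

Lemma orthogonalM (l l' l'' : Objective_I) (g : hom l' l'') (f : hom l l') :
  orthogonal g -> orthogonal f -> orthogonal (g ∘ f).
Proof.
case: g f => [g [ig lg]] [f [jf lf]]; rewrite /orthogonal /ObjI_mor /= => og of_.
by rewrite daggerM //; exact: is_inverseM.
Qed.

Definition Objective_perp : category := wide_subcategory orthogonal1 orthogonalM.

Definition ObjP_mor (l l' : Objective_perp) (f : hom l l') :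
  hom (obj_space l) (obj_space l') := ObjI_mor (wide_mor f).

End Objectives.

Section Optimizers.
Context (K : optimization_domain).

Record optimizer := MkOptimizer {
  opt_space : K;
  opt_dim : nat;
  opt_map : hom (pow opt_space opt_dim) (pow opt_space opt_dim)
}.

Definition opt_cast (A : K) (k k' : nat) (e : k = k')
    (d : hom (pow A k) (pow A k)) : hom (pow A k') (pow A k') :=
  eq_rect k (fun n => hom (pow A n) (pow A n)) d k' e.

(* Morphisms exist only between optimizers of equal dimension; [opt_cast]
   transports the source optimizer along that equality. *)
Definition opt_commutes (d d' : optimizer)
    (f : hom (opt_space d) (opt_space d')) : Prop :=
  exists e : opt_dim d = opt_dim d',
    powm f (opt_dim d') ∘ opt_cast e (opt_map d)
    = opt_map d' ∘ powm f (opt_dim d').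

Record optimizer_hom (d d' : optimizer) := OptimizerHom {
  opt_mor : hom (opt_space d) (opt_space d');
  opt_morP : opt_commutes opt_mor
}.

Lemma optimizer_hom_eq (d d' : optimizer) (f g : optimizer_hom d d') :
  opt_mor f = opt_mor g -> f = g.
Proof.
case: f g => [f pf] [g pg] /= efg; move: pg; rewrite -efg => pg.
by rewrite (proof_irrelevance _ pf pg).
Qed.

Lemma optimizer_id_subproof (d : optimizer) :
  opt_commutes (idm : hom (opt_space d) (opt_space d)).
Proof. by exists erefl; rewrite powm1 comp1m compm1. Qed.

Definition optimizer_id (d : optimizer) : optimizer_hom d d :=
  OptimizerHom (optimizer_id_subproof d).

Lemma optimizer_comp_subproof (d d' d'' : optimizer) (g : optimizer_hom d' d'')
    (f : optimizer_hom d d') : opt_commutes (opt_mor g ∘ opt_mor f).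
Proof.
case: d d' d'' g f => [A k d] [B k' d'] [E k'' d''] [g [/= eg cg]] [f [/= ef cf]].
case: k'' / eg d'' g cg => d'' g cg; case: k' / ef d' d'' f g cf cg => d' d'' f g.
rewrite /opt_commutes /= => cf cg.
by exists erefl; rewrite /= !powmM -compA cf compA cg compA.
Qed.

Definition optimizer_comp (d d' d'' : optimizer) (g : optimizer_hom d' d'')
    (f : optimizer_hom d d') : optimizer_hom d d'' :=
  OptimizerHom (optimizer_comp_subproof g f).

Definition Optimizer : category.
Proof.
refine (@Category optimizer optimizer_hom optimizer_id optimizer_comp _ _ _).
- by move=> *; apply: optimizer_hom_eq; rewrite /= compA.
- by move=> *; apply: optimizer_hom_eq; rewrite /= comp1m.
- by move=> *; apply: optimizer_hom_eq; rewrite /= compm1.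
Defined.

Definition GRAD (l : objective K) : Optimizer :=
  @MkOptimizer (obj_space l) 1 (- gradient (obj_map l)).

Definition MOM (l : objective K) : Optimizer :=
  @MkOptimizer (obj_space l) 2 ⟨π1, - π1 - (gradient (obj_map l) ∘ π0)⟩.

Definition NEW (l : objective K) : Optimizer :=
  @MkOptimizer (obj_space l) 1
    (- R[obj_grad_inv l] ∘ ⟨gradient (obj_map l), gradient (obj_map l)⟩).

End Optimizers.

(* Main.v *)
From mathcomp Require Import all_boot.
Require Import Defs.

Set Implicit Arguments.
Unset Strict Implicit.
Unset Printing Implicit Defensive.

Local Open Scope cat_scope.

(** The chain rule gives [gradient (l' ∘ f) = f^† ∘ gradient l' ∘ f] for linear
    [f].  When [f^†] is the inverse of [f], this says that [f] intertwines the two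
    gradients, hence the gradient descent and momentum maps.  When [f] is merely
    invertible with inverse [g], the inverse gradients are related by
    [H = g ∘ H' ∘ g^†]; reverse-differentiating this identity yields
    [R[H] ∘ ⟨a, c⟩ = g ∘ R[H'] ∘ ⟨g^† ∘ a, g^† ∘ c⟩], and the factors [g^†] cancel
    the [f^†] of the gradient, so Newton's method is preserved without
    orthogonality. *)

Section LinearMaps.
Context (K : reverse_derivative_category).
Implicit Types Z A B : K.

Lemma rev_linear Z A B (f : hom A B) (a : hom Z A) (b : hom Z B) :
  linear f -> R[f] ∘ ⟨a, b⟩ = f^† ∘ b.
Proof. by move=> lf; rewrite dagger_char // -compA proj1_pair. Qed.

(* A linear map is the dagger of its dagger, and reverse derivatives are
   additive in their second argument. *)
Lemma linear_add Z A B (f : hom A B) (a b : hom Z A) :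
  linear f -> f ∘ (a + b) = f ∘ a + f ∘ b.
Proof.
move=> lf; have lf' := dagger_linear lf; have := RD2_add f^† (f ∘ a) a b.
by rewrite !rev_linear // daggerK.
Qed.

Lemma linear_zero Z A B (f : hom A B) : linear f -> f ∘ (0 : hom Z A) = 0.
Proof.
move=> lf; have lf' := dagger_linear lf; have := RD2_zero f^† (0 : hom Z B).
by rewrite rev_linear // daggerK.
Qed.

(** The chain rule applied to [f ∘ g = idm] gives [f ∘ D[g] ∘ ⟨b, b'⟩ = b'], and composing with [g]
    on the left isolates [D[g]]. *)
Lemma linear_inverse A B (f : hom A B) (g : hom B A) :
  is_inverse f g -> linear f -> linear g.
Proof.
move=> [gf fg] lf; apply: prod_ext => Z b b'.
have := forward_comp f g b b'; rewrite fg (linearE _ _ (linear1 B)) comp1m.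
rewrite linearE // => fDg.
by rewrite -compA proj1_pair [in RHS]fDg compA gf comp1m.
Qed.

Lemma dagger_inverse A B (f : hom A B) (g : hom B A) :
  is_inverse f g -> linear f -> is_inverse f^† g^†.
Proof.
move=> fgP lf; have lg := linear_inverse fgP lf; case: fgP => gf fg.
by split; rewrite -daggerM // ?gf ?fg dagger1.
Qed.

End LinearMaps.

Section Negation.
Context (K : optimization_domain).
Implicit Types Z A B : K.

Lemma hopp_unique A B (f g : hom A B) : f + g = 0 -> g = - f.
Proof.
move=> fg0; rewrite -[g]hadd0 -(haddN f) (haddC f) -haddA fg0.
by rewrite haddC hadd0.
Qed.

Lemma hopp_comp Z A B (f : hom A B) (h : hom Z A) : (- f) ∘ h = - (f ∘ h).
Proof. by apply: hopp_unique; rewrite -hadd_comp haddN hzero_comp. Qed.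

Lemma linear_opp Z A B (f : hom A B) (a : hom Z A) :
  linear f -> f ∘ (- a) = - (f ∘ a).
Proof.
by move=> lf; apply: hopp_unique; rewrite -linear_add // haddN linear_zero.
Qed.

End Negation.

Section GradientTransport.
Context (K : optimization_domain).

(** The constant one factors through the terminal object, so it absorbs precomposition with [f];
    this turns the inner factor of the chain rule into [gradient l ∘ f]. *)
Lemma gradient_comp (A B : K) (l : hom B (target K)) (f : hom A B) :
  linear f -> gradient (l ∘ f) = f^† ∘ gradient l ∘ f.
Proof.
move=> lf; rewrite /gradient rev_comp rev_linear // compm1 -!compA.
rewrite pair_comp comp1m /constant_one -compA.
by rewrite (bang_unique (bang B ∘ f)).
Qed.

Lemma gradient_orthogonal (A B : K) (l : hom B (target K)) (f : hom A B) :
  linear f -> is_inverse f f^† -> f ∘ gradient (l ∘ f) = gradient l ∘ f.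
Proof.
by move=> lf [_ ff]; rewrite gradient_comp // -compA (compA f) ff comp1m.
Qed.

Lemma MOM_commutes (A B : K) (l : hom B (target K)) (f : hom A B) :
    linear f -> is_inverse f f^† ->
  (f ⊗ f) ∘ ⟨π1, - π1 - (gradient (l ∘ f) ∘ π0)⟩
  = ⟨π1, - π1 - (gradient l ∘ π0)⟩ ∘ (f ⊗ f).
Proof.
move=> lf /(gradient_orthogonal l lf).
(* Beyond linearity of [f], only the relation [f ∘ G = G' ∘ f] is used from here on. *)
move: (gradient (l ∘ f)) (gradient l) => G G' fG.
rewrite prodm_pair pair_comp linear_add // !linear_opp //.
rewrite hadd_comp !hopp_comp -!compA /prodm !proj0_pair !proj1_pair.
by rewrite (compA f G) fG -compA.
Qed.

Lemma NEW_commutes (A B : K) (l : hom B (target K)) (f : hom A B)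
    (H : hom A A) (H' : hom B B) :
    linear f -> invertible f ->
    is_inverse (gradient (l ∘ f)) H -> is_inverse (gradient l) H' ->
  f ∘ (- R[H] ∘ ⟨gradient (l ∘ f), gradient (l ∘ f)⟩)
  = - R[H'] ∘ ⟨gradient l, gradient l⟩ ∘ f.
Proof.
move=> lf [g fgP] [HG _] invG'.
have lg := linear_inverse fgP lf; have [_ fg] := fgP.
have invf' := dagger_inverse fgP lf.
have defG := gradient_comp l lf; rewrite -compA in defG.
(* Inverting the three factors of the gradient of [l ∘ f] gives a right inverse, which must equal
   the left inverse [H]. *)
have [_] := is_inverseM invf' (is_inverseM invG' fgP); rewrite -defG.
set G := gradient (l ∘ f) in HG defG *; set G' := gradient l in invG' defG *.
rewrite -(compA g) => GH.
have defH : H = g ∘ (H' ∘ g^†) by rewrite -[LHS]compm1 -GH compA HG comp1m.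
have gG : g^† ∘ G = G' ∘ f by rewrite defG (compA g^†) invf'.1 comp1m.
rewrite !hopp_comp linear_opp //; congr (- _).
(* The outer [g] puts [g^†] in the second slot; the inner [g^†] puts [g^†] in the first slot and
   [g^†^† = g] in front. By [gG] both slots become [G' ∘ f], and [f] cancels the front [g]. *)
rewrite defH 2!rev_comp (rev_linear _ _ lg) (rev_linear _ _ (dagger_linear lg)).
by rewrite daggerK // gG compA fg comp1m -compA pair_comp.
Qed.

End GradientTransport.

(** Morphisms of [Optimizer] are determined by their underlying maps, so the functor laws reduce to
    those of [m]. *)
Lemma functor_over_Optimizer (K : optimization_domain) (C : category)
    (Fo : C -> Optimizer K)
    (m : forall l l' : C, hom l l' -> hom (opt_space (Fo l)) (opt_space (Fo l'))) :
    (forall l : C, m l l idm = idm) ->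
    (forall (l l' l'' : C) (g : hom l' l'') (f : hom l l'),
       m l l'' (g ∘ f) = m l' l'' g ∘ m l l' f) ->
    (forall (l l' : C) (f : hom l l'),
       @opt_commutes K (Fo l) (Fo l') (m l l' f)) ->
  exists F : functor_over Fo,
    forall (l l' : C) (f : hom l l'), opt_mor (fmap F f) = m l l' f.
Proof.
move=> m1 mM mP.
unshelve eexists (@FunctorOver C (Optimizer K) Fo
  (fun l l' f => OptimizerHom (mP l l' f)) _ _).
- by move=> l; apply: optimizer_hom_eq; apply: m1.
- by move=> l l' l'' g f; apply: optimizer_hom_eq; apply: mM.
- by [].
Qed.

Theorem proposition3 (K : optimization_domain) :
  (exists F : @functor_over (Objective_I K) (Optimizer K) (@NEW K),
     forall (l l' : Objective_I K) (f : hom l l'), opt_mor (fmap F f) = ObjI_mor f)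
  /\ (exists F : @functor_over (Objective_perp K) (Optimizer K) (@GRAD K),
     forall (l l' : Objective_perp K) (f : hom l l'), opt_mor (fmap F f) = ObjP_mor f)
  /\ (exists F : @functor_over (Objective_perp K) (Optimizer K) (@MOM K),
     forall (l l' : Objective_perp K) (f : hom l l'), opt_mor (fmap F f) = ObjP_mor f).
Proof.
split; [|split].
- apply: (@functor_over_Optimizer K (Objective_I K) (@NEW K) (@ObjI_mor K)) => //.
  move=> [A l H HP] [B l' H' HP'] [[f /= lf] [/= jf linf]].
  (* The dimensions agree by computation, so the cast vanishes; the source objective is then written
     as [l' ∘ f]. *)
  exists erefl; rewrite /ObjI_mor /= -lf.
  by apply: NEW_commutes => //; rewrite lf.
- apply: (@functor_over_Optimizer K (Objective_perp K) (@GRAD K) (@ObjP_mor K)) => //.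
  move=> [A l H HP] [B l' H' HP'] [[[f /= lf] [/= jf linf]] of_].
  exists erefl; rewrite /ObjP_mor /ObjI_mor /= -lf.
  by rewrite linear_opp // hopp_comp gradient_orthogonal.
- apply: (@functor_over_Optimizer K (Objective_perp K) (@MOM K) (@ObjP_mor K)) => //.
  move=> [A l H HP] [B l' H' HP'] [[[f /= lf] [/= jf linf]] of_].
  (* In dimension 2, [powm f 2] computes to [f ⊗ f]. *)
  exists erefl; rewrite /ObjP_mor /ObjI_mor /= -lf.
  exact: MOM_commutes.
Qed.
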